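(* Let $G=(V,E)$ be a (finite) directed graph, possibly containing cycles. If $u,v\in V$ lie in the same strongly connected component of $G$, then $u$ and $v$ lie in the same cluster of every DAG-coarsening of $G$. Consequently, the partition of $V$ into strongly connected components (the SCC coarsening) is the finest DAG-coarsening of $G$: it is a DAG-coarsening, and it refines every DAG-coarsening of $G$. Thus the condensation $G^{\mathrm{sc}}$, which is its quotient graph, is the floor (least element with respect to refinement) of the DAG-coarsenings of $G$.
   Context: For a partition $\Pi$ of $V$ with associated surjection $\chi:V\to\Pi$ sending each vertex to its part (cluster), the quotient graph is $G'=(\Pi,E')$ with $E'=\{(\chi(u),\chi(v)) \mid (u,v)\in E,\ \chi(u)\neq\chi(v)\}$. The partition $\Pi$ is called a DAG-coarsening of $G$ when $G'$ is acyclic (contains no directed cycle). DAG-coarsenings are ordered by refinement of partitions. A strongly connected component (SCC) is an equivalence class of the relation of mutual reachability by directed paths (length $0$ allowed). The SCC coarsening is the partition of $V$ into SCCs; its quotient graph is the condensation $G^{\mathrm{sc}}$. *)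

(* Defs.v *)
From mathcomp Require Import all_boot.

Set Implicit Arguments.
Unset Strict Implicit.
Unset Printing Implicit Defensive.

Record digraph := Digraph { vertex :> finType; edge : rel vertex }.

(* [cycle] is a closed walk, with a singleton [:: x] being a self-loop at x;
   a graph has a nonempty closed walk iff it has a simple directed cycle. *)
Definition acyclic (G : digraph) : Prop :=
  forall c : seq G, cycle (@edge G) c -> c = [::].

(* The surjection chi : V -> P is [pblock P]. *)
Definition quotient_edge (G : digraph) (P : {set {set G}})
    (A B : {A : {set G} | A \in P}) : bool :=
  [exists u : G, exists v : G,
    [&& edge u v, pblock P u != pblock P v,
        val A == pblock P u & val B == pblock P v]].

Definition quotient_graph (G : digraph) (P : {set {set G}}) : digraph :=
  @Digraph {A : {set G} | A \in P} (@quotient_edge G P).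

Definition dag_coarsening (G : digraph) (P : {set {set G}}) : Prop :=
  partition P [set: G] /\ acyclic (quotient_graph P).

Definition refines (T : finType) (P Q : {set {set T}}) : bool :=
  [forall A in P, exists B in Q, A \subset B].

Definition together (T : finType) (P : {set {set T}}) (u v : T) : bool :=
  [exists A in P, (u \in A) && (v \in A)].

Definition mutually_reachable (G : digraph) : rel G :=
  fun u v => connect (@edge G) u v && connect (@edge G) v u.

Definition scc_coarsening (G : digraph) : {set {set G}} :=
  equivalence_partition (@mutually_reachable G) [set: G].

Definition condensation (G : digraph) : digraph :=
  quotient_graph (scc_coarsening G).

Definition finest_dag_coarsening (G : digraph) (P : {set {set G}}) : Prop :=
  dag_coarsening P /\
  forall Q : {set {set G}}, dag_coarsening Q -> refines P Q.

Definition dag_coarsening_floor (G H : digraph) : Prop :=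
  exists2 P : {set {set G}}, finest_dag_coarsening P & H = quotient_graph P.

Lemma refines_refl (T : finType) (P : {set {set T}}) : refines P P.
Proof. by apply/'forall_implyP=> A PA; apply/existsP; exists A; rewrite PA /=. Qed.

Lemma refines_trans (T : finType) (P Q R : {set {set T}}) :
  refines P Q -> refines Q R -> refines P R.
Proof.
move=> /'forall_implyP PQ /'forall_implyP QR; apply/'forall_implyP=> A PA.
have /existsP[B /andP[QB sAB]] := PQ A PA.
have /existsP[C /andP[RC sBC]] := QR B QB.
by apply/existsP; exists C; rewrite RC (subset_trans sAB).
Qed.

Lemma refines_sub (T : finType) (P Q : {set {set T}}) :
  partition P [set: T] -> refines P Q -> refines Q P -> P \subset Q.
Proof.
move=> /and3P[_ tiP P0] /'forall_implyP PQ /'forall_implyP QP.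
apply/subsetP=> A PA.
have /existsP[B /andP[QB sAB]] := PQ A PA.
have /existsP[C /andP[PC sBC]] := QP B QB.
have /set0Pn[x Ax] : A != set0 by apply: contraNneq P0 => <-.
have eAC : A = C.
  rewrite -(def_pblock tiP PA Ax); apply: (def_pblock tiP PC).
  exact: (subsetP sBC _ (subsetP sAB _ Ax)).
by suff -> : A = B by []; apply/eqP; rewrite eqEsubset sAB eAC sBC.
Qed.

Lemma finest_dag_coarsening_unique (G : digraph) (P Q : {set {set G}}) :
  finest_dag_coarsening P -> finest_dag_coarsening Q -> P = Q.
Proof.
move=> [dP leP] [dQ leQ]; apply/eqP; rewrite eqEsubset.
by rewrite !refines_sub ?leP ?leQ //; [case: dQ | case: dP].
Qed.

(* Main.v *)
Require Import Defs.
From mathcomp Require Import all_boot.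

Set Implicit Arguments.
Unset Strict Implicit.
Unset Printing Implicit Defensive.

(* A walk of G projects to a walk of any quotient graph, so mutually reachable
   vertices lie in mutually reachable clusters, and in an acyclic quotient
   mutually reachable clusters coincide. Conversely, a walk between two strongly
   connected components lifts to a walk between any of their representatives, so
   a directed cycle of the condensation would merge the components it visits. *)

Lemma partition_pblock_mem (T : finType) (P : {set {set T}}) (u : T) :
  partition P [set: T] -> pblock P u \in P.
Proof. by move=> partP; rewrite pblock_mem // (cover_partition partP). Qed.

Lemma partition_mem_pblock (T : finType) (P : {set {set T}}) (u : T) :
  partition P [set: T] -> u \in pblock P u.
Proof. by move=> partP; rewrite mem_pblock (cover_partition partP). Qed.

Lemma togetherE (T : finType) (P : {set {set T}}) (u v : T) :
  partition P [set: T] -> together P u v = (pblock P u == pblock P v).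
Proof.
move=> partP; have tiP := partition_trivIset partP.
apply/existsP/eqP => [[A /and3P[PA Au Av]]|eq_uv].
  by rewrite (def_pblock tiP PA Au) (def_pblock tiP PA Av).
exists (pblock P u).
by rewrite partition_pblock_mem // partition_mem_pblock // eq_uv
           partition_mem_pblock.
Qed.

(** Blocks of [P] are nonempty, so each block [A] has some [x]; every other element of [A] is
    together with [x], which puts [A] inside the block of [x] in [Q]. *)
Lemma together_refines (T : finType) (P Q : {set {set T}}) :
  partition P [set: T] -> partition Q [set: T] ->
  (forall u v, together P u v -> together Q u v) -> refines P Q.
Proof.
move=> partP partQ PQ; apply/'forall_implyP=> A PA.
have /set0Pn[x Ax] := partition_neq0 partP PA.
apply/existsP; exists (pblock Q x); rewrite partition_pblock_mem //=.
apply/subsetP=> y Ay.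
have: together P x y by apply/existsP; exists A; rewrite PA Ax Ay.
by move/PQ; rewrite togetherE // => /eqP->; apply: partition_mem_pblock.
Qed.

(** A walk from [u] to [v] followed by one back to [u] is a closed walk; acyclicity makes it empty,
    so the walk [p] to [v] is empty and [v] is [u]. *)
Lemma acyclic_connect_anti (G : digraph) :
  acyclic G -> antisymmetric (connect (@edge G)).
Proof.
move=> acG u v /andP[/connectP[p pth_p v_p] /connectP[q pth_q u_q]].
have lastpq : last u (p ++ q) = u by rewrite last_cat -v_p -u_q.
have: cycle (@edge G) (p ++ q).
  (* The sequences [p] and [q] omit their starting vertices, so [p ++ q] lists the closed walk once,
     with [u] as its last entry; [u] is also the default when it is empty. *)
  by rewrite (cycle_path u) lastpq cat_path pth_p -v_p.
by move/acG; case: p v_p {pth_p lastpq}.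
Qed.

(** Induction on the walk: each edge either stays inside one cluster, contributing no step, or
    crosses between two clusters and is an edge of the quotient. *)
Lemma quotient_connect (G : digraph) (P : {set {set G}})
    (A B : quotient_graph P) (u v : G) :
  partition P [set: G] -> val A = pblock P u -> val B = pblock P v ->
  connect (@edge G) u v -> connect (@edge (quotient_graph P)) A B.
Proof.
move=> partP Au Bv /connectP[p pth_p v_p].
elim: p u A Au pth_p v_p => [|w p IHp] u A Au /=.
  by move=> _ v_u; have -> : A = B by apply: val_inj; rewrite Au Bv v_u.
case/andP=> uw pth_p v_p.
pose C : quotient_graph P :=
  exist (fun A => A \in P) (pblock P w) (partition_pblock_mem w partP).
apply: connect_trans (IHp w C _ pth_p v_p) => //.
have [eq_uw|neq_uw] := eqVneq (pblock P u) (pblock P w).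
  by have -> : A = C by apply: val_inj; rewrite Au eq_uw.
apply: connect1; apply/existsP; exists u; apply/existsP; exists w.
by rewrite uw neq_uw Au !eqxx.
Qed.

Lemma mutually_reachable_together (G : digraph) (P : {set {set G}}) (u v : G) :
  dag_coarsening P -> mutually_reachable u v -> together P u v.
Proof.
move=> [partP acP] /andP[uv vu]; rewrite togetherE //; apply/eqP.
pose cl w : quotient_graph P :=
  exist (fun A => A \in P) (pblock P w) (partition_pblock_mem w partP).
suff /(congr1 val) : cl u = cl v by [].
by apply: (acyclic_connect_anti acP); rewrite (quotient_connect _ _ _ uv) //
          (quotient_connect _ _ _ vu).
Qed.

Lemma mutually_reachable_equivalence (G : digraph) :
  {in [set: G] & &, equivalence_rel (@mutually_reachable G)}.
Proof.
move=> x y z _ _ _; rewrite /mutually_reachable; split=> [|/andP[xy yx]].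
  by rewrite connect0.
apply/andP/andP=> -[h1 h2]; split.
- exact: connect_trans yx h1.
- exact: connect_trans h2 xy.
- exact: connect_trans xy h1.
- exact: connect_trans h2 yx.
Qed.

Lemma scc_coarsening_partition (G : digraph) :
  partition (scc_coarsening G) [set: G].
Proof. exact: equivalence_partitionP (@mutually_reachable_equivalence G). Qed.

Lemma together_scc (G : digraph) (u v : G) :
  together (scc_coarsening G) u v = mutually_reachable u v.
Proof.
have partS := scc_coarsening_partition G.
rewrite togetherE // eq_pblock ?(cover_partition partS) //; last first.
  exact: partition_trivIset partS.
exact: (pblock_equivalence_partition (@mutually_reachable_equivalence G)).
Qed.

(** Vertices of one component reach each other ([same]), so consecutive edges of the condensation
    can be joined inside each component, whichever vertices of [G] witness them. *)
Lemma condensation_connect (G : digraph) (A B : condensation G) (x y : G) :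
  x \in val A -> y \in val B ->
  connect (@edge (condensation G)) A B -> connect (@edge G) x y.
Proof.
have same (C : condensation G) z t :
    z \in val C -> t \in val C -> connect (@edge G) z t.
  move=> Cz Ct; have: together (scc_coarsening G) z t.
    by apply/existsP; exists (val C); rewrite (valP C) Cz Ct.
  by rewrite together_scc => /andP[].
move=> Ax By /connectP[p pth_p B_p].
elim: p A x Ax pth_p B_p => [|C p IHp] A x Ax /=.
  by move=> _ B_A; apply: (same A); rewrite // -B_A.
case/andP=> /existsP[u /existsP[v /and4P[uv _ /eqP A_u /eqP C_v]]] pth_p B_p.
have partS := scc_coarsening_partition G.
(* The lifted walk goes from [x] to [u] inside [A], crosses by the edge from [u] to [v], and
   continues from [v] in [C] by induction. *)
apply: connect_trans (IHp C v _ pth_p B_p).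
  apply: connect_trans (connect1 uv); apply: (same A) => //.
  by rewrite A_u partition_mem_pblock.
by rewrite C_v partition_mem_pblock.
Qed.

Lemma condensation_acyclic (G : digraph) : acyclic (condensation G).
Proof.
(* The cycle splits into its closing edge, from [last A s] back to [A], and the path from [A] along
   [s]. *)
case=> // A s; rewrite (cycle_path A) /= => /andP[e_BA pth_s].
have partS := scc_coarsening_partition G.
have AB : connect (@edge (condensation G)) A (last A s).
  by apply/connectP; exists s.
case/existsP: e_BA => u /existsP[v /and4P[uv neq_uv /eqP B_u /eqP A_v]].
(* The closing edge comes from an edge from [u] to [v] between distinct components; lifting the rest
   of the cycle leads from [v] back to [u], so the two components coincide. *)
case/negP: neq_uv; rewrite -togetherE // together_scc.
rewrite /mutually_reachable (connect1 uv).
by apply: condensation_connect AB; rewrite ?A_v ?B_u partition_mem_pblock.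
Qed.

Lemma scc_coarsening_finest (G : digraph) :
  finest_dag_coarsening (scc_coarsening G).
Proof.
have partS := scc_coarsening_partition G.
split; first by split; [exact: partS | exact: condensation_acyclic].
move=> Q dagQ; apply: together_refines => // [|u v]; first by case: dagQ.
by rewrite together_scc; apply: mutually_reachable_together.
Qed.

Theorem proposition1 (G : digraph) :
  [/\ forall u v : G, together (scc_coarsening G) u v ->
        forall P : {set {set G}}, dag_coarsening P -> together P u v,
      finest_dag_coarsening (scc_coarsening G)
    & dag_coarsening_floor G (condensation G)].
Proof.
split; last by exists (scc_coarsening G); first exact: scc_coarsening_finest.
  by move=> u v; rewrite together_scc => uv P dagP;
     apply: mutually_reachable_together.
exact: scc_coarsening_finest.
Qed.
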